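(* Let $S$ be a finite idempotent semigroup (that is, a finite semigroup with $x\cdot x=x$ for all $x\in S$). Then $S$ is finitely related.
   Context: For an operation $f:X^n\to X$ ($n\ge 1$) and a relation $\rho\subseteq X^k$, $f$ preserves $\rho$ if for all $\bar a_i=(a_{i,1},\dots,a_{i,n})\in X^n$, $1\le i\le k$, such that $(a_{1,j},\dots,a_{k,j})\in\rho$ for every $1\le j\le n$, we have $(f(\bar a_1),\dots,f(\bar a_k))\in\rho$. For a family $\mathcal R$ of finitary relations on $X$, $\mathrm{Pol}(\mathcal R)$ is the set of all finitary operations on $X$ preserving every relation in $\mathcal R$; for a family $\mathcal O$ of operations on $X$, $\mathrm{Inv}(\mathcal O)$ is the set of all finitary relations on $X$ preserved by every operation in $\mathcal O$. For an algebra $\mathbf A=(A,\mathcal F)$, $\mathrm{Clo}(\mathbf A)$ (the clone of $\mathbf A$) is the set of all term operations of $\mathbf A$. For a semigroup $S$, the $n$-ary term operations are exactly the operations $S^n\to S$ obtained by evaluating nonempty words over $x_1,\dots,x_n$ in $S$. A finite algebra $\mathbf A=(A,\mathcal F)$ is finitely related if there is a finite set $\mathcal R\subseteq\mathrm{Inv}(\mathcal F)$ of relations such that $\mathrm{Clo}(\mathbf A)=\mathrm{Pol}(\mathcal R)$. *)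

(* Defs.v *)
From mathcomp Require Import all_boot.

Set Implicit Arguments.
Unset Strict Implicit.
Unset Printing Implicit Defensive.

(* Indexing by the predecessor of the arity rules out nullary operations. *)
Record operation (X : Type) := Operation {
  arity_pred : nat;
  opfun :> arity_pred.+1.-tuple X -> X }.

Definition arity X (f : operation X) : nat := (arity_pred f).+1.

Definition relation (X : finType) := {k : nat & {set k.-tuple X}}.

(* The tuple [a] lists the rows of a matrix whose columns are the tuples of
   [rho]; [f] is applied to each row. *)
Definition preserves (X : finType) (f : operation X) (rho : relation X) : Prop :=
  forall a : (tag rho).-tuple ((arity f).-tuple X),
    (forall j : 'I_(arity f),
       [tuple tnth (tnth a i) j | i < tag rho] \in tagged rho) ->
    [tuple f (tnth a i) | i < tag rho] \in tagged rho.

Definition Pol (X : finType) (R : relation X -> Prop) (f : operation X) : Prop :=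
  forall rho, R rho -> preserves f rho.

Definition Inv (X : finType) (O : operation X -> Prop) (rho : relation X) : Prop :=
  forall f, O f -> preserves f rho.

Record finAlgebra := FinAlgebra {
  carrier :> finType;
  symbol : Type;
  basic : symbol -> operation carrier }.

Definition basic_operations (A : finAlgebra) (f : operation A) : Prop :=
  exists s : symbol A, f = basic s.

Inductive term (A : finAlgebra) (n : nat) : Type :=
| Var of 'I_n
| App (s : symbol A) of ('I_(arity (basic s)) -> term A n).

Fixpoint eval (A : finAlgebra) (n : nat) (t : term A n) (x : n.-tuple A) : A :=
  match t with
  | Var i => tnth x i
  | App s ts => basic s [tuple eval (ts i) x | i < arity (basic s)]
  end.

Definition Clo (A : finAlgebra) (f : operation A) : Prop :=
  exists t : term A (arity f), f =1 eval t.

Definition finitely_related (A : finAlgebra) : Prop :=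
  exists R : seq (relation A),
    (forall rho, rho \in R -> Inv (@basic_operations A) rho) /\
    (forall f : operation A, Clo f <-> Pol (fun rho => rho \in R) f).

Definition binary_operation (X : Type) (mul : X -> X -> X) : operation X :=
  @Operation X 1 (fun x => mul (tnth x ord0) (tnth x ord_max)).

Definition semigroup_algebra (S : finType) (mul : S -> S -> S) : finAlgebra :=
  @FinAlgebra S unit (fun=> binary_operation mul).

(* Main.v *)
Require Import Defs.
From mathcomp Require Import all_boot.

Set Implicit Arguments.
Unset Strict Implicit.
Unset Printing Implicit Defensive.

(** A finite band [S] has finitely related clone as soon as there is a bound [m]
    such that an operation is a term operation whenever all the operations
    obtained from it by identifying its variables down to [m] of them are: the
    finite relation is then the graph of the [m]-ary term operations
    ([term_graph], [word_preserves_term_graph]).  By induction on the number of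
    variables it suffices to pass from the minors obtained by identifying two
    variables to the operation ([word_of_minors], [word_of_small_minors]).

    Let [f] have more variables than [S] has elements.  Every argument of [f]
    repeats a value, so [f] is determined by words [w i j] that compute it where
    the variables [i] and [j] agree, and one looks for a single word [u] that
    agrees with each [w i j] on that set.  If no variable is missing from these
    words, then every [w i j] takes its values in one rectangular band once the
    argument is fixed, so equality splits into Green's relations R and L: a word
    right for R followed by a word right for L is right ([eq_of_RL]).  The
    problem for L is the problem for R in the opposite band.

    To solve the problem for R in [S], two cases arise.
    - If no submonoid [z S z] contains two distinct L-related elements, the
      R-class of the value of a word only depends on its first letter and its
      set of letters, and a solution is found by hand ([Rsolvable_local]).
    - Otherwise [S] contains the two-element left zero band with an identity
      adjoined.  Values in this subband reveal, up to R, which letter of a word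
      occurs first, so all the [w i j] agree on the order in which the letters
      appear.  Let [l] be the last letter in this order and [s] the one before.
      The R-class of a word is that of its prefix before [l], followed by [l];
      hence only the effect of the prefix on the left of R-classes matters, that
      is, its value in the quotient [T] of [S] by the congruence [rho].  In [T],
      the prefixes form a system in one variable less, to be solved for
      equality, that is, for R and for L.  For R no induction is needed: again
      only the prefix before [s] matters, and it can be read off the single word
      [w s l].  So the R-problem for [S] reduces to the L-problem for [T]
      ([Rsolvable_step]).

    The reduction alternates between R and L while taking quotients, so it
    terminates ([Rsolvable_both]) once the case where neither quotient shrinks
    is settled: then distinct elements are never J-related ([trivial_below]),
    which is covered by the first case. *)

(** * Words and their values in a band *)

(** [None] plays the role of an adjoined identity, the value of the empty
    word. *)
Definition omul (S : Type) (mul : S -> S -> S) (s t : option S) : option S :=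
  match s, t with
  | Some x, Some y => Some (mul x y)
  | None, _ => t
  | _, None => s
  end.

Arguments omul : simpl never.

Definition ev (S : Type) (mul : S -> S -> S) (X : Type) (a : X -> S)
    (w : seq X) : option S :=
  foldr (fun x => omul mul (Some (a x))) None w.

Definition opp (S : Type) (mul : S -> S -> S) : S -> S -> S :=
  fun x y => mul y x.

(** Green's relation R, in the form it takes on idempotents; the relation L is
    that of the opposite band. *)
Definition Rrel (S : eqType) (mul : S -> S -> S) (s t : option S) : bool :=
  (omul mul s t == t) && (omul mul t s == s).

(** Turns a word that mentions at least one of [i] and [j] into one that mentions
    both, with the same values where [i] and [j] are given the same value. *)
Definition blend (X : eqType) (i j : X) (w : seq X) : seq X :=
  flatten [seq if x \in [:: i; j] then [:: i; j] else [:: x] | x <- w].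

Section Evaluation.
Variables (S : eqType) (mul : S -> S -> S).
Hypotheses (mulA : associative mul) (mulxx : idempotent_op mul).
Local Notation "s ** t" := (omul mul s t) (at level 40, left associativity).
Local Notation ev := (ev mul).
Local Notation R := (Rrel mul).

Lemma omulA : associative (omul mul).
Proof. by move=> [x|] [y|] [z|] //=; rewrite /omul mulA. Qed.

Lemma omulxx : idempotent_op (omul mul).
Proof. by case=> [x|] //=; rewrite /omul mulxx. Qed.

Lemma omulx1 s : s ** None = s.
Proof. by case: s. Qed.

Lemma oppA : associative (opp mul).
Proof. by move=> x y z; rewrite /opp mulA. Qed.

Lemma omul_opp s t : omul (opp mul) s t = t ** s.
Proof. by case: s; case: t. Qed.

Lemma Rxx s : R s s.
Proof. by rewrite /Rrel omulxx eqxx. Qed.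

Lemma R_sym s t : R s t = R t s.
Proof. by rewrite /Rrel andbC. Qed.

Lemma R_trans s t u : R s t -> R t u -> R s u.
Proof.
move=> /andP[/eqP st /eqP ts] /andP[/eqP tu /eqP ut]; rewrite /Rrel.
by rewrite -[in s ** u]tu omulA st tu eqxx -[in u ** s]ts omulA ut ts eqxx.
Qed.

Lemma R_mull s t u : R t u -> R (s ** t) (s ** u).
Proof.
have step t' u' : t' ** u' = u' -> (s ** t') ** (s ** u') = s ** u'.
  by move=> E; rewrite -{1}E !omulA -(omulA _ s t') omulxx -omulA E.
by move=> /andP[/eqP tu /eqP ut]; rewrite /Rrel !step ?eqxx.
Qed.

(** Multiplying [v = s t u] by [t] on the right stays in its R-class, since
    [v t u = v]; so [v t] and [v] are R-related idempotents. *)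
Lemma omul_absorb s t u : (s ** t ** u) ** t ** (s ** t ** u) = s ** t ** u.
Proof.
have vu : (s ** t ** u) ** t ** u = s ** t ** u.
  by rewrite -!omulA (omulA t u) omulxx.
set v := s ** t ** u in vu *.
by rewrite -[in X in _ ** X]vu omulA omulxx.
Qed.

Section Words.
Variable X : eqType.
Implicit Types (a : X -> S) (u v w : seq X).

Lemma ev1 a x : ev a [:: x] = Some (a x).
Proof. by []. Qed.

Lemma ev_cat a u v : ev a (u ++ v) = ev a u ** ev a v.
Proof. by elim: u => //= x u ->; rewrite omulA. Qed.

Lemma eq_in_ev a b w : {in w, a =1 b} -> ev a w = ev b w.
Proof.
elim: w => //= x w IH ab; rewrite ab ?mem_head // IH // => y yw.
by rewrite ab // inE yw orbT.
Qed.

Lemma ev_subst a (Y : Type) (b : Y -> S) (g : Y -> seq X) (w : seq Y) :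
  (forall y, ev a (g y) = Some (b y)) -> ev a (flatten (map g w)) = ev b w.
Proof. by move=> gb; elim: w => //= y w IH; rewrite ev_cat gb IH. Qed.

Lemma ev_blend a i j w : a i = a j -> ev a (blend i j w) = ev a w.
Proof.
move=> ij; apply: ev_subst => x; case: ifP => //=.
by rewrite !inE /omul /= ij mulxx => /orP[]/eqP->; rewrite ?ij.
Qed.

(** Words with the same letters have their values in one rectangular band. *)
Lemma ev_absorb a u v : {subset u <= v} -> ev a v ** ev a u ** ev a v = ev a v.
Proof.
elim: u v => [|x u IH] v uv /=; first by rewrite omulx1 omulxx.
have /splitPr vE := uv x (mem_head _ _).
have vx : ev a v ** Some (a x) ** ev a v = ev a v.
  by case: vE => p q; rewrite -cat1s catA !ev_cat ev1 omul_absorb.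
(* The induction hypothesis is used for the longer word [v x]. *)
have: {subset u <= v ++ [:: x]} by move=> y yu; rewrite mem_cat uv // inE yu orbT.
move=> /IH; rewrite ev_cat ev1 => vxuvx.
suff -> : ev a v ** (Some (a x) ** ev a u) ** ev a v
    = (ev a v ** Some (a x)) ** ev a u ** (ev a v ** Some (a x)) ** ev a v.
  by rewrite vxuvx vx.
by rewrite -[RHS]omulA vx !omulA.
Qed.
End Words.
End Evaluation.

Section WordValues.
Variables (S : eqType) (mul : S -> S -> S).
Hypotheses (mulA : associative mul) (mulxx : idempotent_op mul).
Variable X : eqType.
Implicit Types (a : X -> S) (u v w : seq X).

Lemma ev_cons a x w : ev mul a (x :: w) = omul mul (Some (a x)) (ev mul a w).
Proof. by []. Qed.

(** The R-class of a word is decided when its last new letter appears. *)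
Lemma R_prefix a u v :
  {subset v <= u} -> Rrel mul (ev mul a (u ++ v)) (ev mul a u).
Proof.
move=> vu; rewrite /Rrel ev_cat //.
by rewrite (ev_absorb mulA mulxx) // omulA // omulxx ?eqxx.
Qed.

Lemma ev_opp a w : ev (opp mul) a w = ev mul a (rev w).
Proof.
by elim: w => //= x w IH; rewrite omul_opp rev_cons -cats1 ev_cat // IH.
Qed.

Lemma ev_cons_some a x w : exists s, ev mul a (x :: w) = Some s.
Proof.
by rewrite [ev _ _ _]/= -/(ev mul a w); case: (ev mul a w) => [t|]; eexists.
Qed.

Lemma ev_mem_some a w x : x \in w -> exists s, ev mul a w = Some s.
Proof. by case: w => // y w _; apply: ev_cons_some. Qed.
End WordValues.

Arguments ev : simpl never.

(** * Systems of words *)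

Definition distinct_in (X : finType) (A : {set X}) (i j : X) : bool :=
  [&& i \in A, j \in A & i != j].

Definition full_content (X : finType) (A : {set X}) (w : X -> X -> seq X) : Prop :=
  forall i j, distinct_in A i j -> w i j =i A.

(** The family [w] behaves as if each [w i j] computed, up to [E], one and the
    same operation where [i] and [j] agree.  Variables range over a subset [A] of
    a fixed type, so that a letter can be dropped without changing the type. *)
Definition coherent (S X : finType) (mul : S -> S -> S) (E : rel (option S))
    (A : {set X}) (w : X -> X -> seq X) : Prop :=
  forall i j k l, distinct_in A i j -> distinct_in A k l ->
  forall a : X -> S, a i = a j -> a k = a l ->
  E (ev mul a (w i j)) (ev mul a (w k l)).

Definition solves (S X : finType) (mul : S -> S -> S) (E : rel (option S))
    (A : {set X}) (w : X -> X -> seq X) (u : seq X) : Prop :=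
  u =i A /\ forall i j, distinct_in A i j -> forall a : X -> S, a i = a j ->
  E (ev mul a u) (ev mul a (w i j)).

Definition solvable (S : finType) (mul : S -> S -> S) (E : rel (option S)) :=
  exists N, forall (X : finType) (A : {set X}) w, N <= #|A| ->
  full_content A w -> coherent mul E A w -> exists u, solves mul E A w u.

Definition Rsolvable (S : finType) (mul : S -> S -> S) : Prop :=
  solvable mul (Rrel mul).

Lemma distinct_in_sub (X : finType) (A B : {set X}) i j :
  A \subset B -> distinct_in A i j -> distinct_in B i j.
Proof. by move=> /subsetP AB /and3P[/AB iB /AB jB ij]; apply/and3P. Qed.

Lemma pigeonhole (X S : finType) (A : {set X}) (a : X -> S) :
  #|S| < #|A| -> exists i j, distinct_in A i j /\ a i = a j.
Proof.
move=> SA.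
have: ~~ [forall i, forall j, distinct_in A i j ==> (a i != a j)].
  apply: contraL SA => /forallP inj; rewrite -leqNgt.
  rewrite -(@card_in_imset _ _ a A) ?max_card // => i j iA jA aij.
  apply/eqP; have /forallP/(_ j) := inj i; rewrite /distinct_in iA jA /= aij eqxx.
  by case: eqP.
by case/forallPn => i /forallPn[j]; rewrite negb_imply negbK =>
  /andP[ij /eqP]; exists i, j.
Qed.

Lemma exists_distinct_in (X : finType) (A : {set X}) :
  1 < #|A| -> exists i j, distinct_in A i j.
Proof.
move=> A2; have [|i [j [ij _]]] := @pigeonhole X unit A (fun=> tt).
  by rewrite card_unit.
by exists i, j.
Qed.

Lemma card_setD1_ge (X : finType) (A : {set X}) x n : n < #|A| -> n <= #|A :\ x|.
Proof. by rewrite (cardsD1 x A); case: (x \in A); [|move/ltnW]. Qed.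

(** * Bands whose local submonoids are L-trivial *)

Definition left_zero (S : eqType) (mul : S -> S -> S) (a b : S) : bool :=
  [&& mul a b == a, mul b a == b & a != b].

(** The elements [z], [a] and [b] form a left zero band with an identity
    adjoined: the product of a word over them is its first letter other than
    [z]. *)
Definition left_zero_unit (S : eqType) (mul : S -> S -> S) (z a b : S) : bool :=
  [&& mul z a == a, mul a z == a, mul z b == b, mul b z == b & left_zero mul a b].

Section Local.
Variables (S : finType) (mul : S -> S -> S).
Hypotheses (mulA : associative mul) (mulxx : idempotent_op mul).
Local Notation ev := (ev mul).
Local Notation R := (Rrel mul).

(** The values [U] and [V] of the two words satisfy [V U V = V], so [U V] and [V]
    are L-related, hence equal. *)
Lemma R_same_content (X : eqType) (a : X -> S) (u v : seq X) :
  (forall b c, ~~ left_zero mul b c) -> u =i v -> R (ev a u) (ev a v).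
Proof.
move=> nolz uv; rewrite /Rrel.
suff half (u' v' : seq X) : u' =i v' -> omul mul (ev a u') (ev a v') == ev a v'.
  by rewrite !half // => x; rewrite uv.
move=> {u v} {}uv; case: v' uv => [|x v] uv.
  by case: u' uv => // y u /(_ y); rewrite mem_head.
have [|U EU] := @ev_mem_some _ mul _ a u' x; first by rewrite uv mem_head.
have [V EV] := ev_cons_some mul a x v.
have /(ev_absorb mulA mulxx a) : {subset u' <= x :: v} by move=> y; rewrite uv.
rewrite EU EV => -[].
move=> VUV; rewrite /omul; apply/eqP; congr Some; apply/eqP.
have := nolz (mul U V) V; rewrite /left_zero negb_and -mulA mulxx eqxx /=.
by rewrite mulA VUV eqxx /= negbK.
Qed.

(** Let [z] be the value of the common first letter.  The elements [U V z] and
    [V z] of the submonoid of [z] are L-related, hence equal. *)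
Lemma R_same_head (X : eqType) (a : X -> S) x (u v : seq X) :
  (forall z b c, ~~ left_zero_unit mul z b c) -> x :: u =i x :: v ->
  R (ev a (x :: u)) (ev a (x :: v)).
Proof.
move=> nolz uv; rewrite /Rrel.
suff half (u' v' : seq X) : x :: u' =i x :: v' ->
    omul mul (ev a (x :: u')) (ev a (x :: v')) == ev a (x :: v').
  by rewrite !half // => y; rewrite uv.
move=> {u v} {}uv.
have [U EU] := ev_cons_some mul a x u'; have [V EV] := ev_cons_some mul a x v'.
set z := a x.
have zx w W : ev a (x :: w) = Some W -> mul z W = W.
  move=> EW; have: omul mul (Some z) (Some W) = Some W.
    by rewrite -EW ev_cons omulA // omulxx.
  by case.
have absorb w W : {subset w <= x :: v'} -> ev a w = Some W ->
    mul (mul V W) V = V.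
  move=> sub EW; have := ev_absorb mulA mulxx a sub; rewrite EV EW.
  by case.
have zU := zx _ _ EU; have zV := zx _ _ EV.
have VzV : mul (mul V z) V = V.
  by apply: (absorb [:: x]) => // y; rewrite !inE => ->.
have VUV : mul (mul V U) V = V.
  by apply: (absorb (x :: u')) => // y; rewrite uv.
have := nolz z (mul (mul U V) z) (mul V z).
rewrite /left_zero_unit /left_zero !mulA zU zV -[mul (mul (mul U V) z) z]mulA.
rewrite -[mul (mul V z) z]mulA !mulxx !eqxx /=.
have -> : mul (mul (mul (mul U V) z) V) z = mul (mul U V) z.
  by rewrite -(mulA U) -(mulA U) VzV.
have -> : mul (mul (mul (mul V z) U) V) z = mul V z.
  by rewrite -(mulA V z U) zU VUV.
rewrite !eqxx /= negbK => /eqP UVz.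
rewrite EU EV /omul; apply/eqP; congr Some.
by rewrite -{1}VzV -!mulA (mulA V) mulA mulA UVz VzV.
Qed.
End Local.

Section LocalSolvable.
Variables (S : finType) (mul : S -> S -> S).
Hypotheses (mulA : associative mul) (mulxx : idempotent_op mul).

Lemma ev_left_zero (X : eqType) (P : pred X) (a b : S) x w : left_zero mul a b ->
  ev mul (fun y => if P y then a else b) (x :: w) = Some (if P x then a else b).
Proof.
move=> /and3P[/eqP ab /eqP ba _]; elim: w x => [|y w IH] x.
  by rewrite ev1.
by rewrite ev_cons IH; do 2!case: (P _); rewrite /omul ?mulxx ?ab ?ba.
Qed.

(** Only the first letter and the set of letters count up to R.  If some left
    zero pair exists, evaluating in it shows that the words of a coherent system
    begin with the same letter [m], apart from identifications; otherwise even the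
    first letter is irrelevant. *)
Lemma Rsolvable_local :
  (forall z a b, ~~ left_zero_unit mul z a b) -> Rsolvable mul.
Proof.
move=> nolz1.
have [lzE | nolz] := boolP [exists a, exists b, left_zero mul a b]; last first.
  exists 0 => X A w _ spr _; exists (enum A); split=> [x|i j ij a _].
    by rewrite mem_enum.
  apply: R_same_content => // [b c|x]; last by rewrite mem_enum spr.
  by move: nolz => /existsPn/(_ b)/existsPn/(_ c).
have /existsP[a /existsP[b ab]] := lzE; have /and3P[/eqP abE /eqP baE anb] := ab.
exists (#|S| + 4) => X A w Nle spr coh.
(* Evaluation in the pair [a], [b] tells whether the first letter satisfies [P]. *)
have headP (P : pred X) i j k l x y u v : distinct_in A i j -> distinct_in A k l ->
    P i = P j -> P k = P l -> w i j = x :: u -> w k l = y :: v -> P x = P y.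
  move=> ij kl Pij Pkl wij wkl.
  have := coh i j k l ij kl (fun x => if P x then a else b).
  rewrite Pij Pkl wij wkl !ev_left_zero // => /(_ erefl erefl).
  case: (P x); case: (P y) => //; rewrite /Rrel /omul ?abE ?baE.
    by case/andP=> /eqP[ab'] _; rewrite ab' eqxx in anb.
  by case/andP=> /eqP[ab'] _; rewrite ab' eqxx in anb.
have wne i j : distinct_in A i j -> exists x u, w i j = x :: u.
  move=> ij; case E: (w i j) => [|x u]; last by exists x, u.
  by have /and3P[iA _ _] := ij; move: (spr i j ij i); rewrite E iA.
(* If [w i j] begins with [i] or [j], then so does [w k l] for other letters [k]
   and [l], and its first letter is not affected by identifying [k] with [l]. *)
have [i [j [ij [m [t [wij /andP[mi mj]]]]]]] : exists i j, distinct_in A i j /\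
    exists m t, w i j = m :: t /\ (m != i) && (m != j).
  have [|i [j ij]] := @exists_distinct_in _ A.
    by apply: leq_trans Nle; rewrite addnC.
  have [m [t wij]] := wne i j ij.
  have [mij|] := boolP ((m != i) && (m != j)); first by exists i, j; split=> //; exists m, t.
  rewrite negb_and !negbK => mij.
  have [|k [l kl]] := @exists_distinct_in _ (A :\ i :\ j).
    by do 2!apply: card_setD1_ge; apply: leq_trans Nle; rewrite addnC.
  have klA : distinct_in A k l.
    apply: distinct_in_sub kl; rewrite !subDset.
    by apply/subsetP=> x; rewrite !inE => ->; rewrite !orbT.
  have [m' [t' wkl]] := wne k l klA.
  exists k, l; split=> //; exists m', t'; split=> //.
  move: kl; rewrite /distinct_in !inE => /and3P[/and3P[kj ki _] /and3P[lj li _] _].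
  have := headP (pred2 i j) i j k l m m' t t' ij klA.
  rewrite /= !eqxx orbT (negPf kj) (negPf ki) (negPf lj) (negPf li) mij.
  move=> /(_ erefl erefl wij wkl)/esym/orP[]/eqP->.
    by rewrite ![i == _]eq_sym ki li.
  by rewrite ![j == _]eq_sym kj lj.
have mA : m \in A by rewrite -(spr i j ij) wij mem_head.
have mhead k l : distinct_in (A :\ m) k l -> exists u, w k l = m :: u.
  move=> kl; have klA : distinct_in A k l := distinct_in_sub (subsetDl _ _) kl.
  have [m' [u wkl]] := wne k l klA.
  move: kl; rewrite /distinct_in !inE => /and3P[/andP[km _] /andP[lm _] _].
  have := headP (pred1 m) i j k l m m' t u ij klA.
  rewrite /= ![_ == m]eq_sym in km lm *.
  rewrite (negPf km) (negPf lm) (negPf mi) (negPf mj) eqxx.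
  by move=> /(_ erefl erefl wij wkl)/esym/eqP <-; exists u.
exists (m :: enum A); have uA : m :: enum A =i A.
  by move=> x; rewrite inE mem_enum; case: eqP => // ->.
split=> // k l kl c ckl.
(* Any argument repeats a value away from [m]. *)
have [|k' [l' [kl' ckl']]] := @pigeonhole _ _ (A :\ m) c.
  by apply: card_setD1_ge; apply: leq_trans Nle; rewrite addnC ltnW.
have kl'A : distinct_in A k' l' := distinct_in_sub (subsetDl _ _) kl'.
apply: R_trans (coh _ _ _ _ kl'A kl c ckl' ckl) => //.
have [u wkl] := mhead _ _ kl'; rewrite wkl.
apply: R_same_head => // x; rewrite uA -wkl spr //.
Qed.
End LocalSolvable.

(** * The congruence describing the action on R-classes *)

(** Two words without the letter [x] can be exchanged before the first
    occurrence of [x], up to R, exactly when their values are related by [rho]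
    for every argument. *)
Definition rho (S : finType) (mul : S -> S -> S) (x y : S) : bool :=
  [forall s, Rrel mul (Some (mul x s)) (Some (mul y s))].

(** [T] is the quotient of [S] by [rho], with projection [h] and section [g].  It
    is kept abstract so that [S] itself can serve when [rho] is trivial. *)
Record rho_quotient (S : finType) (mul : S -> S -> S)
    (T : finType) (mulT : T -> T -> T) (h : S -> T) (g : T -> S) : Prop := {
  quoA : associative mulT;
  quoxx : idempotent_op mulT;
  quoM : {morph h : x y / mul x y >-> mulT x y};
  quoK : cancel g h;
  quoE : forall x y, (h x == h y) = rho mul x y }.

Section Quotient.
Variables (S : finType) (mul : S -> S -> S).
Hypotheses (mulA : associative mul) (mulxx : idempotent_op mul).
Local Notation rho := (rho mul).

Lemma rhoP x y :
  reflect (forall s, Rrel mul (Some (mul x s)) (Some (mul y s))) (rho x y).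
Proof. exact: forallP. Qed.

Lemma rhoxx x : rho x x.
Proof. by apply/rhoP => s; apply: Rxx. Qed.

Lemma rho_sym x y : rho x y = rho y x.
Proof. by apply: eq_forallb => s; rewrite R_sym. Qed.

Lemma rho_trans x y z : rho x y -> rho y z -> rho x z.
Proof.
by move=> /rhoP xy /rhoP yz; apply/rhoP => s; apply: R_trans (xy s) (yz s).
Qed.

Lemma rho_mull z x y : rho x y -> rho (mul z x) (mul z y).
Proof.
move=> /rhoP xy; apply/rhoP => s; rewrite -!mulA.
exact: (R_mull mulA mulxx (Some z) (xy s)).
Qed.

Lemma rho_mulr z x y : rho x y -> rho (mul x z) (mul y z).
Proof. by move=> /rhoP xy; apply/rhoP => s; rewrite -!mulA. Qed.

Let rep x := choose (rho x) x.

Let rho_rep x : rho x (rep x).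
Proof. exact: chooseP (rhoxx x). Qed.

Let repE x y : (rep x == rep y) = rho x y.
Proof.
apply/eqP/idP => [E | xy].
  by apply: rho_trans (rho_rep x) _; rewrite E rho_sym rho_rep.
rewrite /rep (@eq_choose _ (rho x) (rho y)) => [|z].
  by apply: choose_id; rewrite ?rhoxx // rho_sym.
by apply/idP/idP; apply: rho_trans; rewrite // rho_sym.
Qed.

Lemma exists_rho_quotient : exists (T : finType) (mulT : T -> T -> T) h g,
  rho_quotient mul mulT h g /\
  (forall x y, rho x y -> x != y -> #|T| < #|S|).
Proof.
have repK x : rep (rep x) == rep x by rewrite repE rho_sym rho_rep.
pose T : finType := {x : S | rep x == x}.
pose h x : T := exist _ (rep x) (repK x).
exists T, (fun x y : T => h (mul (val x) (val y))), h, val.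
have hE x y : (h x == h y) = rho x y by rewrite -val_eqE /= repE.
have hM x y : h (mul x y) = h (mul (rep x) (rep y)).
  apply/eqP; rewrite hE; apply: rho_trans (rho_mulr _ (rho_rep x)) _.
  exact: rho_mull (rho_rep y).
have hK : cancel val h by move=> [x /= xP]; apply/val_inj/eqP.
split; first split=> //=.
- move=> x y z; apply/eqP; rewrite hE -{1}(hK x) -{2}(hK z) /=.
  by rewrite -hE -!hM mulA.
- by move=> x; rewrite mulxx hK.
move=> x y xy /negP nxy; rewrite card_sig.
apply: proper_card; apply/properP; split; first by apply/subsetP.
have [rx|rx] := boolP (rep x == x); last by exists x; rewrite ?inE.
exists y; rewrite ?inE //; apply/negP=> ry; apply: nxy.
by rewrite -(eqP rx) -(eqP ry) repE.
Qed.

Lemma self_rho_quotient :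
  (forall x y, rho x y -> x = y) -> rho_quotient mul mul id id.
Proof.
move=> triv; split=> // x y; apply/eqP/idP => [->|/triv //].
exact: rhoxx.
Qed.
End Quotient.

Section Trivial.
Variables (S : finType) (mul : S -> S -> S).
Hypotheses (mulA : associative mul) (mulxx : idempotent_op mul).

Lemma mul_absorb s x t v : mul (mul s x) t = v -> mul (mul v x) v = v.
Proof.
move=> <-; have := omul_absorb mulA mulxx (Some s) (Some x) (Some t).
by case.
Qed.

(** [t] is below [x] in the order of J-classes. *)
Definition below (x t : S) : bool := mul (mul t x) t == t.

(** R-related elements [a] and [b] satisfy [rho], provided that J-classes strictly
    below that of [a] are trivial: for every [s], either [a s] and [b s] stay in
    the R-class of [a], or they fall into one smaller J-class and are equal. *)
Lemma R_trivial_step (a b : S) :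
  (forall x y, rho mul x y -> x = y) ->
  (forall x y, #|below x| < #|below a| -> below x y -> below y x -> x = y) ->
  mul a b = b -> mul b a = a -> a = b.
Proof.
move=> triv IH ab ba; apply: triv; apply/rhoP => s.
have sub c d : mul c d = d -> mul d c = c -> below (mul c s) (mul d s).
  move=> cd dc; have : {subset [:: c; s] <= [:: c; d; s]}.
    by move=> x; rewrite !inE => /orP[]->; rewrite ?orbT.
  move=> /(ev_absorb mulA mulxx id); rewrite !ev_cons !omulx1 => -[].
  by rewrite !(mulA c d) cd => /eqP.
have [sa|sa] := boolP (below s a); last first.
  rewrite (_ : mul a s = mul b s) ?Rxx //; apply: IH; rewrite ?sub //.
  apply: proper_card; apply/properP; split.
    apply/subsetP=> t; rewrite !unfold_in => /eqP tE; apply/eqP.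
    by apply: (mul_absorb (s := t) (t := mul s t)); rewrite -[RHS]tE !mulA.
  exists a; rewrite !unfold_in /below ?mulxx //.
  by rewrite mulA mulxx.
have sb : below s b.
  have asa := eqP sa; apply/eqP; apply: (mul_absorb (s := a) (t := b)).
  by rewrite -[in LHS]ab mulA asa.
have cs c : below s c -> Rrel mul (Some (mul c s)) (Some c).
  by move=> /eqP csc; rewrite /Rrel /omul csc mulA mulxx !eqxx.
apply: R_trans (cs a sa) _ => //; rewrite R_sym; apply: R_trans (cs b sb) _ => //.
by rewrite /Rrel /omul ab ba !eqxx.
Qed.
End Trivial.

Lemma below_opp (S : finType) (mul : S -> S -> S) (mulA : associative mul) x :
  below (opp mul) x =1 below mul x.
Proof. by move=> t; rewrite /below /opp mulA. Qed.

(** J-related elements [x] and [y] are linked by [x y], which is R-related to [x]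
    and L-related to [y].  The induction is on the number of elements below
    [x]. *)
Lemma trivial_below (S : finType) (mul : S -> S -> S)
    (mulA : associative mul) (mulxx : idempotent_op mul) :
  (forall x y, rho mul x y -> x = y) ->
  (forall x y, rho (opp mul) x y -> x = y) ->
  forall x y, below mul x y -> below mul y x -> x = y.
Proof.
move=> trivR trivL x; have [n] := ubnP #|below mul x|.
elim: n x => // n IH x; rewrite ltnS => xn y /eqP yxy /eqP xyx.
have Rx b : mul x b = b -> mul b x = x -> x = b.
  apply: R_trivial_step => // z t zx; apply: IH; exact: leq_trans xn.
have Lx b : mul b x = b -> mul x b = x -> x = b.
  apply: (@R_trivial_step _ (opp mul)) => //; first exact: oppA.
  move=> z t; rewrite !(eq_card (below_opp mulA _)) !(below_opp mulA) => zx.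
  apply: IH; exact: leq_trans xn.
have xy : x = mul x y by apply: Rx; rewrite // mulA mulxx.
apply: Lx; last by rewrite -xy.
by rewrite xy mulA yxy.
Qed.

(** * The order of first occurrences *)

(** Some letter in [K] occurs, and does so before any letter in [Q]. *)
Definition before (X : Type) (K Q : pred X) (w : seq X) : bool :=
  find K w < find Q w.

Definition prefix_before (X : Type) (Q : pred X) (w : seq X) : seq X :=
  take (find Q w) w.

Section Order.
Variable X : eqType.
Implicit Types (K Q : pred X) (w : seq X).

Lemma before_has K Q w : before K Q w -> has K w.
Proof. by move=> KQ; rewrite has_find (leq_trans KQ) ?find_size. Qed.

Lemma before_pred2 K x y w :
  before K (pred1 x) w -> before K (pred1 y) w -> before K (pred2 x y) w.
Proof.
rewrite /before; elim: w => //= v w IH; case: (K v); first by do 2!case: eqP.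
by do 2!case: eqP => //= _; rewrite !ltnS.
Qed.

Lemma before_sub K K' Q w : subpred K K' -> before K Q w -> before K' Q w.
Proof. by move=> KK'; apply: leq_ltn_trans; apply: sub_find. Qed.

Lemma before_cat K Q u v : has Q u -> before K Q (u ++ v) -> before K Q u.
Proof.
rewrite /before !find_cat => Qu; rewrite Qu; case: ifP => // _.
by rewrite ltnNge (leq_trans (find_size _ _)) // leq_addr.
Qed.

Lemma mem_pre x Q w : (x \in prefix_before Q w) = before (pred1 x) Q w.
Proof. by rewrite -has_pred1 has_take_leq // find_size. Qed.

Lemma pre_split Q w : has Q w -> exists x r, Q x /\ w = prefix_before Q w ++ x :: r.
Proof.
elim: w => //= x w IH; rewrite /prefix_before /=; case: ifP => [Qx _ | _ /= /IH].
  by exists x, w.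
by case=> y [r [Qy wE]]; exists y, r; split=> //=; rewrite {1}wE.
Qed.

Lemma mem_blend i j x w :
  (x \in blend i j w) =
    (x \in w) || (x \in [:: i; j]) && ((i \in w) || (j \in w)).
Proof.
elim: w => [|y w IH]; first by rewrite andbF.
rewrite /blend /= mem_cat -/(blend i j w) IH !inE.
case: ifP; rewrite !inE ![i == _]eq_sym ![j == _]eq_sym.
  case/orP=> /eqP->; rewrite eqxx ?orbT /= ?andbT;
  by case: (x == i); case: (x == j); case: (x \in w); rewrite ?orbT.
by move/norP=> [/negPf-> /negPf->] /=; rewrite orbA.
Qed.
End Order.

Lemma exists_max (X : finType) (A : {set X}) (r : rel X) :
  0 < #|A| -> (forall x, ~~ r x x) ->
  (forall y x z, x \in A -> y \in A -> z \in A -> r x y -> r y z -> r x z) ->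
  (forall x y, x \in A -> y \in A -> x != y -> r x y || r y x) ->
  exists2 m, m \in A & forall x, x \in A -> x != m -> r x m.
Proof.
move=> /card_gt0P[x0 x0A] irr tr tot.
case: (arg_maxnP (fun x => #|[set y in A | r y x]|) x0A) => m mA0 mmax.
have mA : m \in A := mA0.
exists m => // x xA xm; have /orP[//|mx] := tot x m xA mA xm.
have := mmax x xA; rewrite /= leqNgt; case/negP; apply: proper_card.
apply/properP; split; last by exists m; rewrite inE mA ?mx ?(negPf (irr m)).
by apply/subsetP=> y; rewrite !inE => /andP[yA ym]; rewrite yA (tr m).
Qed.

(** If [y] is the last new letter of [v], the R-class of [v] is that of the prefix
    before [y] followed by [y].  The order of occurrences is known only after
    identifying [i] and [j], so the prefix is first completed to contain both;
    this does not change its value where [i] and [j] agree. *)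
Lemma prefix_word (X : finType) (B : {set X}) (y i j : X) (v : seq X) :
  y \in B -> distinct_in (B :\ y) i j -> v =i B ->
  (forall m, m \in B :\ y -> m != i -> m != j ->
     before (pred1 m) (pred1 y) v) ->
  before (pred2 i j) (pred1 y) v ->
  blend i j (prefix_before (pred1 y) v) =i B :\ y /\
  forall (S : finType) (mul : S -> S -> S) (a : X -> S),
    associative mul -> idempotent_op mul -> a i = a j ->
    Rrel mul (ev mul a v)
      (omul mul (ev mul a (blend i j (prefix_before (pred1 y) v))) (Some (a y))).
Proof.
move=> yB /and3P[iB jB ij] vB bef befij.
set p := blend i j _.
have pB : p =i B :\ y.
  move=> x; rewrite mem_blend !mem_pre.
  have -> : before (pred1 i) (pred1 y) v || before (pred1 j) (pred1 y) v.
    rewrite -!mem_pre; move: befij; rewrite /before -has_take_leq ?find_size //.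
    by case/hasP=> t tv /=; case/orP=> /eqP <-; rewrite tv ?orbT.
  rewrite andbT !inE; have [->|xi] /= := eqVneq x i.
    by rewrite !inE in iB; rewrite iB orbT.
  have [->|xj] /= := eqVneq x j; first by rewrite !inE in jB; rewrite jB orbT.
  rewrite orbF; apply/idP/idP => [xy | xB]; last by apply: bef; rewrite ?inE.
  rewrite -vB; apply/andP; split; last by rewrite -has_pred1 (before_has xy).
  by apply: contraL xy => /eqP->; rewrite /before ltnn.
split=> // S mul a mulA mulxx aij.
have yv : has (pred1 y) v by rewrite has_pred1 vB.
have [_ [r [/eqP-> vE]]] := pre_split yv.
have -> : ev mul a v = ev mul a ((p ++ [:: y]) ++ r).
  by rewrite vE -cat1s catA !ev_cat // ev_blend.
rewrite -(ev1 mul a y) -ev_cat //; apply: R_prefix => // x xr.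
rewrite mem_cat pB !inE orbC; case: eqP => //= _.
by rewrite -vB vE mem_cat inE xr !orbT.
Qed.

Section Probe.
Variables (S : eqType) (mul : S -> S -> S) (mulxx : idempotent_op mul).
Variables (z a b : S) (zab : left_zero_unit mul z a b).
Variable X : eqType.
Implicit Types (K Q : pred X) (w : seq X).

(** The argument that detects whether a letter in [K] comes before the letters in
    [Q]. *)
Definition probe K Q (x : X) : S := if Q x then b else if K x then a else z.

Lemma ev_probe K Q w : ev mul (probe K Q) w =
  if before K Q w then Some a else if has Q w then Some b else
  if w is [::] then None else Some z.
Proof.
have /and5P[/eqP za /eqP az /eqP zb /eqP bz /and3P[/eqP ab /eqP ba _]] := zab.
elim: w => //= x w IH; rewrite ev_cons IH /before /= /probe.
case: (Q x) => /=.
  case: ifP; rewrite /omul ?ba //; case: ifP; rewrite ?mulxx //.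
  by case: w {IH} => //; rewrite bz.
case: (K x) => /=.
  case: ifP; rewrite /omul ?mulxx //; case: ifP; rewrite ?ab //.
  by case: w {IH} => //; rewrite az.
rewrite ltnS; case: ifP; rewrite /omul ?za //; case: ifP; rewrite ?zb //.
by case: w {IH} => //; rewrite mulxx.
Qed.

(** R-related elements among [z], [a] and [b] are equal. *)
Lemma R_before K Q u v :
  Rrel mul (ev mul (probe K Q) u) (ev mul (probe K Q) v) ->
  before K Q u -> before K Q v.
Proof.
have /and5P[/eqP za /eqP az /eqP zb /eqP bz /and3P[/eqP ab /eqP ba nab]] := zab.
rewrite !ev_probe => + u1; rewrite u1; case: ifP => // _.
rewrite /Rrel /omul; case: ifP => _.
  by rewrite ab => /andP[/eqP[abE] _]; rewrite abE eqxx in nab.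
case: v => [|? ?] //; rewrite az => /andP[/eqP[azE] _].
by rewrite -ab azE zb eqxx in nab.
Qed.
End Probe.

(** * Reduction of the R-problem to the L-problem in the quotient *)

Lemma eq_of_RL (S : eqType) (mul : S -> S -> S) (mulA : associative mul)
    (X : eqType) (a : X -> S) (p q v : seq X) :
  idempotent_op mul -> {subset q ++ v <= p} ->
  Rrel mul (ev mul a q) (ev mul a p) ->
  Rrel (opp mul) (ev mul a v) (ev mul a p) ->
  ev mul a (q ++ v) = ev mul a p.
Proof.
move=> mulxx /(ev_absorb mulA mulxx a) absorb /andP[_ /eqP pq].
rewrite /Rrel !(omul_opp mul) => /andP[_ /eqP vp].
by rewrite -[RHS]absorb ev_cat // omulA // pq -omulA // vp.
Qed.

Lemma eq_ev (S : Type) (mul : S -> S -> S) (X : Type) (c d : X -> S) w :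
  c =1 d -> ev mul c w = ev mul d w.
Proof. by move=> cd; elim: w => // x w IH; rewrite /ev /= cd -!/(ev _ _ w) IH. Qed.

Section Step.
Variables (S : finType) (mul : S -> S -> S).
Hypotheses (mulA : associative mul) (mulxx : idempotent_op mul).
Variables (T : finType) (mulT : T -> T -> T) (h : S -> T) (g : T -> S).
Hypothesis quo : rho_quotient mul mulT h g.
Variables (z a b : S) (zab : left_zero_unit mul z a b).
Local Notation "s ** t" := (omul mul s t) (at level 40, left associativity).
Local Notation R := (Rrel mul).

Lemma ev_quo (X : Type) (c : X -> S) w :
  ev mulT (h \o c) w = omap h (ev mul c w).
Proof.
elim: w => //= x w IH.
rewrite [LHS]/(ev _ _ _) /= -/(ev mulT (h \o c) w) IH.
rewrite [in RHS]/ev /= -/(ev mul c w).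
by case: (ev mul c w) => //= t; rewrite /omul (quoM quo).
Qed.

Lemma quo_R (s t : option S) : omap h s = omap h t ->
  forall x, R (s ** Some x) (t ** Some x).
Proof.
case: s t => [s|] [t|] //= => [[E]|_] x; last exact: Rxx.
by move/eqP: E; rewrite (quoE quo) => /rhoP/(_ x).
Qed.

Lemma R_quo (X : eqType) (c : X -> S) u v x : x \in u -> x \in v ->
  (forall t, R (ev mul c u ** Some t) (ev mul c v ** Some t)) ->
  omap h (ev mul c u) = omap h (ev mul c v).
Proof.
move=> xu xv; have [s ->] := ev_mem_some mul c xu.
have [t ->] := ev_mem_some mul c xv => /= st.
by congr Some; apply/eqP; rewrite (quoE quo); apply/rhoP.
Qed.

Lemma avoid3 (X : finType) (A : {set X}) x y t : 5 <= #|A| ->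
  exists k l, [/\ k \in A, l \in A & k != l] /\
    [/\ k != x, k != y & k != t] /\ [/\ l != x, l != y & l != t].
Proof.
move=> A5; have [|k [l]] := @exists_distinct_in _ (A :\ x :\ y :\ t).
  by do 3!apply: card_setD1_ge.
rewrite /distinct_in !inE => /and3P[/and4P[? ? ? ?] /and4P[? ? ? ?] ?].
by exists k, l.
Qed.

Ltac neqs := rewrite /= ?eqxx; repeat match goal with
  | H : is_true (~~ (?x == ?y)) |- context [?x == ?y] => rewrite (negPf H)
  | H : is_true (~~ (?x == ?y)) |- context [?y == ?x] =>
      rewrite (eq_sym y x) (negPf H) end; rewrite ?orbT ?andbT //.

Ltac pairs := rewrite /distinct_in ?inE; repeat (apply/andP; split);
  try assumption; try (rewrite eq_sym; assumption).

(** The order of first occurrence is common to the whole system; [l] is the last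
    letter and [s] the one before it.  With [q0] the prefix of [w s l] before both
    of these letters, and [v] a solution in [T] of the L-problem for the prefixes
    before [l], the solution is [q0 s v l]: in [T] the word [q0 s v] has the value
    of each prefix before [l], being R-related to it because of [q0 s] and
    L-related to it because of [v]. *)
Lemma Rsolvable_step : Rsolvable (opp mulT) -> Rsolvable mul.
Proof.
(* The margin allows the pigeonhole principle after dropping [l] and [s], and the
   choice of two letters avoiding three given ones. *)
move=> [N solT]; exists (N + #|S| + #|T| + 8) => X A w Ale spr coh.
have A5 : 5 <= #|A| by apply: leq_trans Ale; rewrite addnC.
have bcoh (K Q : pred X) i j k l : distinct_in A i j -> distinct_in A k l ->
    K i = K j -> Q i = Q j -> K k = K l -> Q k = Q l ->
    before K Q (w i j) -> before K Q (w k l).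
  move=> ij kl Kij Qij Kkl Qkl; apply: (R_before mulxx zab).
  by apply: coh; rewrite // /probe ?Kij ?Qij ?Kkl ?Qkl.
(* The letter [i] comes before [j] in every word of the system that identifies
   neither of them; by coherence one such word is enough. *)
pose prec i j := [forall k, forall l,
  distinct_in (A :\ i :\ j) k l ==> before (pred1 i) (pred1 j) (w k l)].
have precE i j k l : prec i j -> k \in A -> l \in A -> k != l ->
    k != i -> k != j -> l != i -> l != j -> before (pred1 i) (pred1 j) (w k l).
  move=> /forallP/(_ k)/forallP/(_ l)/implyP H *; apply: H; pairs.
have precI i j k l : k \in A -> l \in A -> k != l ->
    k != i -> k != j -> l != i -> l != j ->
    before (pred1 i) (pred1 j) (w k l) -> prec i j.
  move=> kA lA kl ki kj li lj bef; apply/forallP=> k'; apply/forallP=> l'.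
  apply/implyP; rewrite /distinct_in !inE.
  case/and3P=> /and3P[k'j k'i k'A] /and3P[l'j l'i l'A] kl'.
  by apply: bcoh bef; [pairs | pairs | neqs | neqs | neqs | neqs].
have precxx i : ~~ prec i i.
  have [k [l [[? ? ?] [[? ? ?] [? ? ?]]]]] := avoid3 i i i A5.
  apply/negP=> ii; suff: before (pred1 i) (pred1 i) (w k l) by rewrite /before ltnn.
  exact: precE ii _ _ _ _ _ _ _.
have prec_tr j i k : i \in A -> j \in A -> k \in A ->
    prec i j -> prec j k -> prec i k.
  move=> _ _ _ ij jk; have [t [l [[? ? ?] [[? ? ?] [? ? ?]]]]] := avoid3 i j k A5.
  apply: (precI i k t l) => //.
  by apply: ltn_trans (precE _ _ t l ij _ _ _ _ _ _ _) (precE _ _ t l jk _ _ _ _ _ _ _).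
have prec_tot i j : i \in A -> j \in A -> i != j -> prec i j || prec j i.
  move=> iA jA ij; have [t [l [[tA lA tl] [[? ? ?] [? ? ?]]]]] := avoid3 i i j A5.
  have wtl : w t l =i A by apply: spr; pairs.
  have : index i (w t l) != index j (w t l).
    apply: contra_neq ij => E; rewrite -(nth_index i (s := w t l) (x := i)) ?wtl //.
    by rewrite E nth_index // wtl.
  rewrite neq_ltn => /orP[] bef; apply/orP; [left | right];
    by apply: (precI _ _ t l).
have A0 : 0 < #|A| by apply: leq_trans A5.
have [l lA lmax] := exists_max A0 precxx prec_tr prec_tot.
set A1 := A :\ l.
have A1A x : x \in A1 -> x \in A by rewrite inE => /andP[].
have A1l x : x \in A1 -> x != l by rewrite !inE => /andP[].
have A1le : N + #|S| + #|T| + 7 <= #|A1|.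
  by apply: card_setD1_ge; rewrite -addnS.
have A10 : 0 < #|A1| by apply: leq_trans A1le; rewrite addnC.
have [s sA1 smax] : exists2 s, s \in A1 & forall x, x \in A1 -> x != s -> prec x s.
  apply: exists_max => // [x y t /A1A xA /A1A yA /A1A tA | x y /A1A xA /A1A yA].
    exact: prec_tr.
  exact: prec_tot.
set A2 := A1 :\ s.
have A2A1 x : x \in A2 -> x \in A1 by rewrite inE => /andP[].
have A2s x : x \in A2 -> x != s by rewrite !inE => /andP[].
have A2le : N + #|S| + #|T| + 6 <= #|A2|.
  by apply: card_setD1_ge; rewrite -addnS.
have sl := A1l _ sA1; have sA := A1A _ sA1.
(* [p i j] is the prefix of [w i j] before the last letter [l]. *)
pose p i j := blend i j (prefix_before (pred1 l) (w i j)).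
have pP i j : distinct_in A1 i j -> p i j =i A1 /\ forall c : X -> S, c i = c j ->
    R (ev mul c (w i j)) (ev mul c (p i j) ** Some (c l)).
  move=> ijA1; have /and3P[iA1 jA1 ij] := ijA1.
  have il := A1l _ iA1; have jl := A1l _ jA1.
  have iA := A1A _ iA1; have jA := A1A _ jA1.
  have ijA : distinct_in A i j by pairs.
  have [||pE pR] := @prefix_word _ A l i j (w i j) lA ijA1 (spr i j ijA).
  - move=> m mA1 mi mj; apply: precE (lmax m (A1A _ mA1) (A1l _ mA1)) _ _ _ _ _ _ _ => //;
    by rewrite eq_sym.
  - have [t [k [[tA kA tk] [[ti tj tl] [ki kj kl]]]]] := avoid3 i j l A5.
    apply: (bcoh (pred2 i j) (pred1 l) t k);
      [by pairs | by [] | by neqs | by neqs | by neqs | by neqs | ].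
    apply: (@before_sub _ (pred1 i)) => [x /=|]; first by move=> ->.
    exact: precE (lmax i iA il) _ _ _ _ _ _ _.
  by split=> // c cij; apply: pR.
(* An arbitrary value at [l] turns R in [S] into equality in [T]. *)
have cohT i j k t (c : X -> T) : distinct_in A1 i j -> distinct_in A1 k t ->
    c i = c j -> c k = c t -> ev mulT c (p i j) = ev mulT c (p k t).
  move=> ij kt cij ckt; have [pij Rij] := pP i j ij; have [pkt Rkt] := pP k t kt.
  have /and3P[iA1 jA1 _] := ij; have /and3P[kA1 tA1 _] := kt.
  have cE : c =1 h \o (g \o c) by move=> x /=; rewrite (quoK quo).
  rewrite !(eq_ev mulT _ cE) !ev_quo.
  apply: (R_quo (x := s)) => [||x]; rewrite ?pij ?pkt //.
  pose c' y := if y == l then x else g (c y).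
  have c'E y : y \in A1 -> c' y = g (c y) by move=> /A1l/negPf; rewrite /c' => ->.
  have c'l : c' l = x by rewrite /c' eqxx.
  have evE u : u =i A1 -> ev mul (g \o c) u = ev mul c' u.
    by move=> uA1; apply: eq_in_ev => y; rewrite uA1 => /c'E->.
  have c'ij : c' i = c' j by rewrite !c'E // cij.
  have c'kt : c' k = c' t by rewrite !c'E // ckt.
  rewrite !evE // -c'l; apply: R_trans (Rkt c' c'kt) => //.
  rewrite R_sym; apply: R_trans (Rij c' c'ij) => //.
  by apply: coh => //; [apply: distinct_in_sub kt | apply: distinct_in_sub ij]; apply: subsetDl.
have [v [vA1 vL]] : exists v, v =i A1 /\ forall i j, distinct_in A1 i j ->
    forall c : X -> T, c i = c j ->
    Rrel (opp mulT) (ev mulT c v) (ev mulT c (p i j)).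
  have [|||v [vA1 vL]] := solT X A1 (fun i j => rev (p i j)).
  - by apply: leq_trans A1le; rewrite -!addnA leq_addr.
  - by move=> i j /pP[pE _] x; rewrite mem_rev pE.
  - move=> i j k t ij kt c cij ckt; rewrite !(ev_opp (quoA quo)) !revK.
    by rewrite (cohT i j k t) //; apply: Rxx => x; rewrite /opp (quoxx quo).
  exists (rev v); split=> [x|i j ij c cij]; first by rewrite mem_rev vA1.
  have := vL i j ij c cij; by rewrite !(ev_opp (quoA quo)) revK.
(* Identifying [s] with [l] leaves the letters before them untouched. *)
set q0 := prefix_before (pred2 s l) (w s l).
have slA : distinct_in A s l by pairs.
have q0E : q0 =i A2.
  move=> x; rewrite mem_pre; apply/idP/idP => [bef | xA2]; last first.
    have xs := A2s _ xA2; have xA1 := A2A1 _ xA2; have xl := A1l _ xA1.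
    have xA := A1A _ xA1.
    have [t [k [[tA kA tk] [[tx ts tl] [kx ks kl]]]]] := avoid3 x s l A5.
    apply: (bcoh (pred1 x) (pred2 s l) t k);
      [by pairs | by [] | by neqs | by neqs | by neqs | by neqs | ].
    by apply: before_pred2; [apply: precE (smax x xA1 xs) _ _ _ _ _ _ _
      |apply: precE (lmax x xA xl) _ _ _ _ _ _ _].
  rewrite !inE -(spr s l slA) -has_pred1 (before_has bef) andbT.
  by apply/andP; split; apply: contraL bef => /eqP->; rewrite /before -leqNgt;
    apply: sub_find => y /= ->; rewrite ?orbT.
pose p2 i j := blend i j (prefix_before (pred1 s) (p i j)).
have sub21 i j : distinct_in A2 i j -> distinct_in A1 i j.
  by apply: distinct_in_sub; apply: subsetDl.
have sub1 i j : distinct_in A1 i j -> distinct_in A i j.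
  by apply: distinct_in_sub; apply: subsetDl.
(* [p2 i j] is the prefix of [p i j] before its last letter [s]. *)
have p2P i j : distinct_in A2 i j -> p2 i j =i A2 /\
    forall (S' : finType) (m : S' -> S' -> S') (c : X -> S'),
      associative m -> idempotent_op m -> c i = c j ->
      Rrel m (ev m c (p i j)) (omul m (ev m c (p2 i j)) (Some (c s))).
  move=> ijA2; have ijA1 := sub21 i j ijA2; have ijA := sub1 i j ijA1.
  have /and3P[iA2 jA2 ij] := ijA2; have /and3P[iA1 jA1 _] := ijA1.
  have /and3P[iA jA _] := ijA.
  have [is_ js] := (A2s _ iA2, A2s _ jA2); have [il jl] := (A1l _ iA1, A1l _ jA1).
  have [pE pR] := pP i j ijA1.
  have wp (K : pred X) : K i = K j -> ~~ K l -> before K (pred1 s) (w i j) ->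
      before K (pred1 s) (p i j).
    move=> Kij Kl bef; apply: (@before_cat _ _ _ _ [:: l]).
      by rewrite has_pred1 pE.
    apply: (R_before mulxx zab) bef.
    have pl : probe z a b K (pred1 s) l = z by rewrite /probe (negPf Kl); neqs.
    rewrite ev_cat // ev1; apply: pR; rewrite /probe Kij; neqs.
  apply: prefix_word => //.
  - move=> m mA2 mi mj; have mA1 := A2A1 _ mA2; have ml := A1l _ mA1.
    have ms := A2s _ mA2.
    apply: wp; [by neqs | by neqs | ].
    by apply: precE (smax m mA1 ms) _ _ _ _ _ _ _ => //; rewrite eq_sym.
  - have [t [k [[tA kA tk] [[ti tj ts] [ki kj ks]]]]] := avoid3 i j s A5.
    apply: wp; [by neqs | by neqs | ].
    apply: (bcoh (pred2 i j) (pred1 s) t k);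
      [by pairs | by [] | by neqs | by neqs | by neqs | by neqs | ].
    apply: (@before_sub _ (pred1 i)) => [x /=|]; first by move=> ->.
    exact: precE (smax i iA1 is_) _ _ _ _ _ _ _.
(* Giving [s] and [l] one arbitrary value makes both prefixes visible in the
   coherence of [w i j] with [w s l]. *)
have p2q0 i j (c : X -> T) : distinct_in A2 i j -> c i = c j ->
    ev mulT c (p2 i j) = ev mulT c q0.
  move=> ijA2 cij; have ijA1 := sub21 i j ijA2; have ijA := sub1 i j ijA1.
  have /and3P[iA2 jA2 _] := ijA2.
  have [pE pR] := pP i j ijA1; have [p2E p2R] := p2P i j ijA2.
  have cE : c =1 h \o (g \o c) by move=> x /=; rewrite (quoK quo).
  rewrite !(eq_ev mulT _ cE) !ev_quo.
  apply: (R_quo (x := i)) => [||x]; rewrite ?p2E ?q0E //.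
  pose c' y := if (y == s) || (y == l) then x else g (c y).
  have c'E y : y \in A2 -> c' y = g (c y).
    by move=> yA2; rewrite /c' (negPf (A2s _ yA2)) (negPf (A1l _ (A2A1 _ yA2))).
  have c's : c' s = x by rewrite /c' eqxx.
  have c'l : c' l = x by rewrite /c' eqxx orbT.
  have evE u : u =i A2 -> ev mul (g \o c) u = ev mul c' u.
    by move=> uA2; apply: eq_in_ev => y; rewrite uA2 => /c'E->.
  have c'ij : c' i = c' j by rewrite !c'E // cij.
  have Rw : R (ev mul c' (w i j)) (ev mul c' (w s l)).
    by apply: coh; rewrite // c's c'l.
  rewrite !evE //.
  have Rq0 : R (ev mul c' (w s l)) (ev mul c' q0 ** Some x).
    have /pre_split[y [r [ysl wE]]] : has (pred2 s l) (w s l).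
      by apply/hasP; exists s; rewrite ?spr //= eqxx.
    have c'y : c' y = x by case/orP: ysl => /eqP->.
    have -> : ev mul c' (w s l) = ev mul c' ((q0 ++ [:: s; l]) ++ r).
      rewrite wE -/q0 !ev_cat // !ev_cons c's c'l c'y omulx1.
      by rewrite [Some x ** Some x]omulxx // omulA.
    have -> : ev mul c' q0 ** Some x = ev mul c' (q0 ++ [:: s; l]).
      by rewrite ev_cat // !ev_cons c's c'l omulx1 omulxx.
    apply: R_prefix => // t tr; have : t \in A.
      by rewrite -(spr s l slA) wE mem_cat inE tr !orbT.
    by rewrite mem_cat q0E !inE => ->; case: (t == s); case: (t == l).
  apply: R_trans Rq0 => //; apply: R_trans Rw => //; rewrite R_sym.
  apply: R_trans (pR c' c'ij) _ => //.
  have -> : ev mul c' (p i j) ** Some (c' l) = ev mul c' (p i j ++ [:: s]).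
    by rewrite ev_cat // ev1 c's c'l.
  apply: R_trans (R_prefix mulA mulxx c' _) _ => // [y|].
    by rewrite inE => /eqP->; rewrite pE.
  by rewrite -c's; apply: p2R.
have AT : #|T| < #|A2|.
  by apply: leq_trans A2le; rewrite addnS ltnS (leq_trans _ (leq_addr _ _)) // leq_addl.
have AS : #|S| < #|A1|.
  apply: leq_trans A1le; rewrite addnS ltnS -!addnA.
  by rewrite (leq_trans _ (leq_addl _ _)) // leq_addr.
(* Any argument repeats a value among the letters other than [s] and [l], so it is
   enough to compare with the words [p k t] for such letters [k] and [t]. *)
have qvE i j (c : X -> T) : distinct_in A1 i j -> c i = c j ->
    ev mulT c ((q0 ++ [:: s]) ++ v) = ev mulT c (p i j).
  move=> ij cij; have [k [t [kt ckt]]] := pigeonhole c AT.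
  have ktA1 := sub21 k t kt; have [pE _] := pP k t ktA1.
  rewrite (cohT i j k t) //; apply: eq_of_RL; try exact: quoA quo; try exact: quoxx quo.
  - move=> x; rewrite !mem_cat q0E vA1 pE mem_seq1 -orbA.
    by case/or3P=> [/A2A1|/eqP->|].
  - rewrite R_sym ev_cat ?ev1; last exact: quoA quo.
    rewrite -(p2q0 k t) //; apply: (p2P k t kt).2 => //; [exact: quoA quo | exact: quoxx quo].
  - exact: vL.
exists (((q0 ++ [:: s]) ++ v) ++ [:: l]); split.
  move=> x; rewrite !mem_cat q0E vA1 !inE.
  have [->|xl] := eqVneq x l; first by rewrite orbT lA.
  have [->|xs] := eqVneq x s; first by rewrite sA !orbT.
  by rewrite /= !orbF orbb.
move=> i j ij c cij; have [k [t [kt ckt]]] := pigeonhole c AS.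
have ktA := sub1 k t kt; have [pE pR] := pP k t kt.
apply: R_trans (coh k t i j ktA ij c ckt cij) => //.
rewrite R_sym; apply: R_trans (pR c ckt) _ => //.
rewrite ev_cat // ev1; apply: quo_R; rewrite -!ev_quo (qvE k t) //=.
by rewrite ckt.
Qed.
End Step.

(** * Solvability over all finite bands *)

Lemma Rsolvable_quo (S T : finType) (mul : S -> S -> S) (mulT : T -> T -> T) h g :
  associative mul -> idempotent_op mul -> rho_quotient mul mulT h g ->
  Rsolvable (opp mulT) -> Rsolvable mul.
Proof.
move=> mulA mulxx quo solT.
have [/existsP[z /existsP[a /existsP[b zab]]] | /existsPn nolz1] :=
    boolP [exists z, exists a, exists b, left_zero_unit mul z a b].
  exact: (Rsolvable_step mulA mulxx quo zab solT).
apply: Rsolvable_local => // z a b.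
by have /existsPn/(_ a)/existsPn/(_ b) := nolz1 z.
Qed.

(** Induction on the size of [S].  If only one of the two quotients is proper, the
    R-problem on that side follows by induction, and the other side reduces to it
    with [S] as its own quotient.  If neither is, [S] is J-trivial. *)
Lemma Rsolvable_both (S : finType) (mul : S -> S -> S) :
  associative mul -> idempotent_op mul -> Rsolvable mul /\ Rsolvable (opp mul).
Proof.
have [n] := ubnP #|S|; elim: n => // n IH in S mul *; rewrite ltnS => Sn mulA mulxx.
have shrink (m : S -> S -> S) : associative m -> idempotent_op m ->
    (forall x y, rho m x y -> x = y) \/ Rsolvable m.
  move=> mA mxx; have [triv | ntriv] := boolP [forall x, forall y, rho m x y ==> (x == y)].
    left=> x y xy; apply/eqP.
    by have /forallP/(_ x)/forallP/(_ y)/implyP := triv; apply.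
  right; have [T [mulT [h [g [quo Tlt]]]]] := exists_rho_quotient mA mxx.
  apply: (Rsolvable_quo mA mxx quo); apply: (IH T mulT _ _ _).2.
  - have /forallPn[x /forallPn[y]] := ntriv; rewrite negb_imply => /andP[xy nxy].
    exact: leq_trans (Tlt x y xy nxy) Sn.
  - exact: quoA quo.
  - exact: quoxx quo.
have oA := oppA mulA; have oxx : idempotent_op (opp mul) by move=> x; apply: mulxx.
have [trivR | solR] := shrink mul mulA mulxx;
  have [trivL | solL] := shrink (opp mul) oA oxx; try by split.
- have nolz (m : S -> S -> S) : idempotent_op m ->
      (forall x y, below m x y -> below m y x -> x = y) ->
      forall z a b, ~~ left_zero_unit m z a b.
    move=> mxx J z a b; apply/negP=> /and5P[_ _ _ _ /and3P[/eqP ab /eqP ba /eqP]].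
    by apply; apply: J; rewrite /below ?ab ?ba ?mxx // ?ab ?ba.
  have J := trivial_below mulA mulxx trivR trivL.
  split; apply: Rsolvable_local => //; apply: nolz => // x y.
  by rewrite !(below_opp mulA); apply: J.
- by split=> //; apply: (Rsolvable_quo mulA mulxx (self_rho_quotient mulA mulxx trivR)).
- by split=> //; apply: (Rsolvable_quo oA oxx (self_rho_quotient oA oxx trivL)).
Qed.

Lemma eq_solvable (S : finType) (mul : S -> S -> S) :
  associative mul -> idempotent_op mul -> solvable mul eq_op.
Proof.
move=> mulA mulxx; have [[N solR] [M solL]] := Rsolvable_both mulA mulxx.
exists (N + M) => X A w Ale spr coh.
have [|i j k l ij kl a aij akl|u [uA uR]] := solR X A w _ spr.
- by apply: leq_trans Ale; rewrite leq_addr.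
- by rewrite (eqP (coh i j k l ij kl a aij akl)) Rxx.
have [||i j k l ij kl a aij akl|v [vA vL]] := solL X A (fun i j => rev (w i j)).
- by apply: leq_trans Ale; rewrite leq_addl.
- by move=> i j ij x; rewrite mem_rev spr.
- rewrite !(ev_opp mulA) !revK (eqP (coh i j k l ij kl a aij akl)).
  by apply: Rxx => x; apply: mulxx.
exists (u ++ rev v); split=> [x|i j ij a aij].
  by rewrite mem_cat mem_rev uA vA orbb.
apply/eqP; apply: eq_of_RL => //.
- by move=> x; rewrite mem_cat mem_rev uA vA orbb spr.
- exact: uR.
- by have := vL i j ij a aij; rewrite !(ev_opp mulA) revK.
Qed.

(** * Operations all of whose minors are words *)

Lemma ev_map (S : Type) (mul : S -> S -> S) (X Y : Type) (g : Y -> X) (c : X -> S) w :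
  ev mul c (map g w) = ev mul (c \o g) w.
Proof. by rewrite /ev foldr_map. Qed.

Section Minors.
Variables (S : finType) (mul : S -> S -> S).
Hypotheses (mulA : associative mul) (mulxx : idempotent_op mul).

(** In a two-element semilattice a word detects the set of its letters. *)
Lemma ev_indicator (X : eqType) (K : pred X) (o e : S) x w :
  mul o e = e -> mul e o = e ->
  ev mul (fun y => if K y then e else o) (x :: w) =
    Some (if has K (x :: w) then e else o).
Proof.
move=> oe eo; elim: w x => [|y w IH] x; first by rewrite /= orbF.
rewrite ev_cons IH /omul /=.
by case: (K x) => /=; case: ifP; rewrite ?mulxx ?oe ?eo.
Qed.

(** If the words for the minors, blended, contain all the letters of [A], they form
    a coherent system.  In a rectangular band this can be arranged, because
    inserting letters inside [w w] does not change the value.  Otherwise a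
    two-element subsemilattice shows that a letter missing from one word is
    missing from all, so [G] does not depend on it, and replacing it by another
    letter gives a word for [G]. *)
Lemma word_of_minors : exists N, forall (X : finType) (A : {set X})
    (G : (X -> S) -> S), N <= #|A| ->
  (forall c d : X -> S, {in A, c =1 d} -> G c = G d) ->
  (forall i j, distinct_in A i j -> exists w, forall c : X -> S,
     c i = c j -> ev mul c w = Some (G c)) ->
  exists w, forall c : X -> S, ev mul c w = Some (G c).
Proof.
have [N sol] := eq_solvable mulA mulxx; exists (N + #|S| + 4).
move=> X A G Ale loc minors.
have N_A : N <= #|A| by apply: leq_trans Ale; rewrite -addnA leq_addr.
have S_A : #|S| + 3 < #|A| by apply: leq_trans Ale; rewrite -addnS -addnA leq_addl.
have S_A' : #|S| < #|A| by apply: leq_trans S_A; rewrite ltnS leq_addr.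
have [x0 x0A] : exists x, x \in A by apply/card_gt0P; apply: leq_trans S_A'.
(* Letters outside [A] can be renamed, as [G] only depends on [A]. *)
pose r x := if x \in A then x else x0.
have rE x : x \in A -> r x = x by rewrite /r => ->.
have [w wP] : exists w : X -> X -> seq X, forall i j, distinct_in A i j ->
    {subset w i j <= A} /\
    forall c : X -> S, c i = c j -> ev mul c (w i j) = Some (G c).
  apply: (@fin_all_exists X (fun=> X -> seq X)
    (fun i wi => forall j, distinct_in A i j -> {subset wi j <= A} /\
       forall c : X -> S, c i = c j -> ev mul c (wi j) = Some (G c))) => i.
  apply: (@fin_all_exists X (fun=> seq X)
    (fun j wij => distinct_in A i j -> {subset wij <= A} /\
       forall c : X -> S, c i = c j -> ev mul c wij = Some (G c))) => j.
  have [ij|] := boolP (distinct_in A i j); last by exists [::].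
  have [w wG] := minors i j ij; have /and3P[iA jA _] := ij.
  exists (map r w) => _; split=> [x /mapP[y _ ->]|c cij].
    by rewrite /r; case: ifP.
  rewrite ev_map wG /= ?rE //; congr Some; apply: loc => x xA /=.
  by rewrite rE.
have finish w' : full_content A w' -> (forall i j, distinct_in A i j -> forall c : X -> S,
    c i = c j -> ev mul c (w' i j) = Some (G c)) ->
    exists u, forall c : X -> S, ev mul c u = Some (G c).
  move=> spr w'G; have [|u [_ uE]] := sol X A w' N_A spr.
    by move=> i j k l ij kl c cij ckl; rewrite (w'G i j) // (w'G k l).
  exists u => c; have [i [j [ij cij]]] := pigeonhole c S_A'.
  by rewrite (eqP (uE i j ij c cij)) w'G.
have [rect | ] := boolP [forall x, forall y, mul (mul x y) x == x].
  apply: (finish (fun i j => w i j ++ enum A ++ w i j)) => [i j ij x|i j ij c cij].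
    have [sub _] := wP i j ij; rewrite !mem_cat mem_enum.
    have := sub x; case: (x \in A); rewrite ?orbT ?orbF ?orbb //.
    by move=> H; apply/idP => /H.
  have [_ wG] := wP i j ij; rewrite !ev_cat // (wG c cij) // omulA //.
  case: (ev mul c (enum A)) => [t|]; rewrite /omul ?mulxx //.
  by have /forallP/(_ (G c))/forallP/(_ t)/eqP-> := rect.
case/forallPn=> o /forallPn[y].
set e := mul (mul o y) o => neo.
have oe : mul o e = e by rewrite /e !mulA mulxx.
have eo : mul e o = e by rewrite /e -!mulA mulxx.
have [full | ] := boolP [forall i, forall j, distinct_in A i j ==>
    [forall k in A, k \in blend i j (w i j)]].
  apply: (finish (fun i j => blend i j (w i j))) => i j ij.
    have [sub _] := wP i j ij; have /and3P[iA jA _] := ij; move=> x.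
    apply/idP/idP => [|xA]; last first.
      have /forallP/(_ i)/forallP/(_ j) := full; rewrite ij.
      by move/forall_inP; apply.
    rewrite mem_blend => /orP[/sub //|/andP[]].
    by rewrite !inE => /orP[]/eqP->.
  by move=> c cij; rewrite ev_blend //; apply: (wP i j ij).2.
case/forallPn=> i /forallPn[j]; rewrite negb_imply => /andP[ij].
case/forall_inPn=> k kA; rewrite mem_blend => /norP[kw kij].
have /and3P[iA jA _] := ij.
(* [K] is the class of the missing letter [k] when [i] and [j] are identified. *)
pose K : pred X := if k \in [:: i; j] then pred2 i j else pred1 k.
have [Kij Kk] : K i = K j /\ K k.
  rewrite /K; case: ifP; rewrite !inE /= ?eqxx ?orbT // ![k == _]eq_sym.
  by case: (i == k); case: (j == k).
have Kw : ~~ has K (w i j).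
  apply/hasP=> -[x xw]; rewrite /K; move: kij; case: ifP => /= [_ /norP[iw jw]|_ _].
    by case/orP=> /eqP xE; rewrite xE ?(negPf iw) ?(negPf jw) in xw.
  by move/eqP=> xE; rewrite -xE xw in kw.
have KA' x : x \in A :\ i :\ j :\ k -> K x = false.
  rewrite /K !inE => /and4P[/negPf xk /negPf xj /negPf xi _].
  by case: ifP => /= _; rewrite ?xk ?xi ?xj.
have sub l m : distinct_in (A :\ i :\ j :\ k) l m -> distinct_in A l m.
  apply: distinct_in_sub; rewrite !subDset.
  by apply/subsetP=> x; rewrite !inE => ->; rewrite !orbT.
have Kw' l m : distinct_in (A :\ i :\ j :\ k) l m -> ~~ has K (w l m).
  move=> lm; have /and3P[lA' mA' _] := lm.
  have [_ wlm] := wP l m (sub l m lm); have [_ wij] := wP i j ij.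
  pose c x := if K x then e else o.
  have := wij c; rewrite /c Kij => /(_ erefl).
  have := wlm c; rewrite /c !KA' // => /(_ erefl).
  case Elm: (w l m) => [|x u] //; case Eij: (w i j) => [|y' v] //.
  rewrite !ev_indicator // -Elm -Eij (negPf Kw) => <- -[].
  by case: ifP => // _ E; rewrite E eqxx in neo.
have A'le : #|S| < #|A :\ i :\ j :\ k|.
  by do 3!apply: card_setD1_ge; apply: leq_trans S_A; rewrite addnC.
have indep (c d : X -> S) : (forall x, ~~ K x -> c x = d x) -> G c = G d.
  move=> cd; have [l [m [lm clm]]] := pigeonhole c A'le.
  have [_ wlm] := wP l m (sub l m lm); have /and3P[lA' mA' _] := lm.
  have dlm : d l = d m by rewrite -!cd ?KA'.
  apply: Some_inj; rewrite -(wlm c clm) -(wlm d dlm); apply: eq_in_ev => x xw.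
  by apply: cd; apply: contra (Kw' l m lm) => Kx; apply/hasP; exists x.
have [l lA kl] : exists2 l, l \in A & l != k.
  have [|l [m]] := @exists_distinct_in _ (A :\ k); last first.
    by case/and3P; rewrite !inE => /andP[lk lA] _ _; exists l.
  by apply: card_setD1_ge; apply: leq_trans S_A; rewrite addnC.
have kl' : distinct_in A l k by rewrite /distinct_in lA kA kl.
have [_ wlk] := wP l k kl'.
pose f x := if x == k then l else x.
exists (map f (w l k)) => c; rewrite ev_map wlk /f /= ?eqxx ?(negPf kl) //.
congr Some; apply: indep => x Kx /=.
by case: eqP => // xE; rewrite xE Kk in Kx.
Qed.
End Minors.

(** Maps [f] identify variables; the induction is on the number of variables left,
    starting from at most [m]. *)
Lemma word_of_small_minors (S : finType) (mul : S -> S -> S) :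
  associative mul -> idempotent_op mul ->
  exists m, forall (X : finType) (x0 : X) (F : (X -> S) -> S),
  (forall c d : X -> S, c =1 d -> F c = F d) ->
  (forall f : X -> 'I_m, exists w, forall c : 'I_m -> S,
     ev mul c w = Some (F (c \o f))) ->
  exists w, forall c : X -> S, ev mul c w = Some (F c).
Proof.
move=> mulA mulxx; have [m Hm] := word_of_minors mulA mulxx.
exists m => X x0 F ext small.
suff collapse n (f : X -> X) : #|f @: [set: X]| < n ->
    exists w, forall c : X -> S, ev mul c w = Some (F (c \o f)).
  by have [w wF] := collapse _ id (leqnn _); exists w => c; rewrite wF.
elim: n f => // n IH f; rewrite ltnS; set A := f @: _ => An.
have fA x : f x \in A by apply: imset_f.
have [Am | mA] := leqP #|A| m.
  have idx x : index (f x) (enum A) < m.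
    by apply: leq_trans Am; rewrite cardE index_mem mem_enum.
  have [w wF] := small (fun x => Ordinal (idx x)).
  exists (map (fun j : 'I_m => nth x0 (enum A) j) w) => c.
  rewrite ev_map wF; congr Some; apply: ext => x /=.
  by rewrite nth_index // mem_enum.
apply: (Hm X A (fun c => F (c \o f))) => [|c d cd|i j].
- exact: ltnW.
- by apply: ext => x; apply: cd.
case/and3P=> iA jA ij.
have [|w wF] := IH (fun x => if f x == j then i else f x).
  apply: leq_trans An; apply: proper_card; apply/properP; split.
    by apply/subsetP=> _ /imsetP[x _ ->]; case: ifP.
  exists j => //; apply/imsetP=> -[x _]; case: ifP => [_ ji|/eqP fx jf].
    by move: ij; rewrite ji eqxx.
  exact: fx (esym jf).
exists w => c cij; rewrite wF; congr Some; apply: ext => x /=.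
by case: eqP => [->|].
Qed.

(** * The graph of the term operations *)

Section TermGraph.
Variables (S : finType) (mul : S -> S -> S) (m : nat).
Local Notation V := {ffun 'I_m -> S}.
Local Notation ev := (ev mul).

Definition projection_tuple (i : 'I_m) : #|{: V}|.-tuple S :=
  [tuple (enum_val c : V) i | c < #|{: V}|].

(** The graph of the term operations is generated by reachability along these
    steps, which makes membership decidable. *)
Definition append_letter (t t' : #|{: V}|.-tuple S) : bool :=
  [exists j, t' ==
    [tuple mul (tnth t c) (tnth (projection_tuple j) c) | c < #|{: V}|]].

Definition term_graph : relation S :=
  existT _ #|{: V}|
    [set t | [exists i, connect append_letter (projection_tuple i) t]].

Definition spells (w : seq 'I_m) (t : #|{: V}|.-tuple S) : Prop :=
  forall c, ev (enum_val c : V) w = Some (tnth t c).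

Hypothesis (mulA : associative mul).

Lemma term_graphP t :
  t \in tagged term_graph <-> exists2 w, w != [::] & spells w t.
Proof.
rewrite inE; split.
  case/existsP=> i /connectP[p]; have : spells [:: i] (projection_tuple i).
    by move=> c; rewrite tnth_mktuple.
  move: [:: i] (projection_tuple i) (isT : [:: i] != [::]).
  move=> w t0 w0 wt0 pth ->.
  elim: p t0 w w0 wt0 pth => [|t1 p IH] t0 w w0 wt0 /=; first by exists w.
  case/andP=> /existsP[j /eqP t1E]; apply: (IH _ (rcons w j)); first by case: (w).
  by move=> c; rewrite -cats1 ev_cat // wt0 ev1 t1E !tnth_mktuple.
case=> -[//|x w] _ wt; apply/existsP; exists x.
elim/last_ind: w t wt => [|w y IH] t wt.
  rewrite (_ : t = projection_tuple x) ?connect0 //.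
  by apply: eq_from_tnth => c; move: (wt c); rewrite ev1 tnth_mktuple => -[].
pose t' := [tuple odflt ((enum_val c : V) x) (ev (enum_val c : V) (x :: w))
             | c < #|{: V}|].
have wt' : spells (x :: w) t'.
  move=> c; rewrite tnth_mktuple.
  by have [s ->] := ev_cons_some mul (enum_val c : V) x w.
apply: connect_trans (IH t' wt') (connect1 _).
apply/existsP; exists y; apply/eqP/eq_from_tnth => c; rewrite tnth_mktuple.
apply: Some_inj; rewrite -wt -rcons_cons -cats1 ev_cat // wt' ev1.
by rewrite [tnth (projection_tuple y) c]tnth_mktuple.
Qed.

(** Substituting words for the letters of a word gives a word. *)
Lemma word_preserves_term_graph (f : operation S) (w : seq 'I_(arity f)) :
  w != [::] -> (forall x, ev (tnth x) w = Some (f x)) -> preserves f term_graph.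
Proof.
move=> w0 wf a cols; apply/term_graphP.
have [v vP] : exists v : 'I_(arity f) -> seq 'I_m, forall j, v j != [::] /\
    forall c, ev (enum_val c : V) (v j) = Some (tnth (tnth a c) j).
  apply: (@fin_all_exists _ (fun=> seq 'I_m) (fun j vj => vj != [::] /\
    forall c, ev (enum_val c : V) vj = Some (tnth (tnth a c) j))) => j.
  have [v v0 vP] := (term_graphP _).1 (cols j).
  by exists v; split=> // c; rewrite vP tnth_mktuple.
exists (flatten (map v w)) => [|c].
  by case: w w0 {wf} => //= j w _; case: (v j) (vP j).1.
rewrite tnth_mktuple -wf; apply: ev_subst => // j.
exact: (vP j).2.
Qed.
End TermGraph.

Section Clone.
Variables (S : finType) (mul : S -> S -> S).
Hypothesis (mulA : associative mul).
Local Notation A := (semigroup_algebra mul).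

Lemma word_of_term n (t : term A n) : exists2 w : seq 'I_n, w != [::] &
  forall x : n.-tuple S, ev mul (tnth x) w = Some (eval t x).
Proof.
elim: t => [i | [] ts IH]; first by exists [:: i].
have [u u0 uE] := IH ord0; have [v _ vE] := IH ord_max.
exists (u ++ v) => [|x]; first by case: u u0 {uE}.
by rewrite ev_cat // uE vE /= !tnth_mktuple.
Qed.

Lemma term_of_word n (i : 'I_n) (w : seq 'I_n) : exists t : term A n,
  forall x : n.-tuple S, ev mul (tnth x) (i :: w) = Some (eval t x).
Proof.
elim: w i => [|j w IH] i; first by exists (Var A i).
have [t tE] := IH j.
exists (@App A n tt (fun k => if k == ord0 then Var A i else t)) => x.
by rewrite ev_cons tE /= !tnth_mktuple.
Qed.

Lemma CloP (f : operation S) : @Clo A f <->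
  exists w : seq 'I_(arity f), forall x, ev mul (tnth x) w = Some (f x).
Proof.
split=> [[t ft] | [[|i w] wf]].
- by have [w _ wt] := word_of_term t; exists w => x; rewrite wt ft.
- by exists (Var A ord0) => x; have := wf x.
- have [t tw] := term_of_word i w; exists t => x.
  by apply: Some_inj; rewrite -tw wf.
Qed.
End Clone.

Theorem theorem1p1 (S : finType) (mul : S -> S -> S)
    (mulA : associative mul) (mulxx : idempotent_op mul) :
  finitely_related (semigroup_algebra mul).
Proof.
have [m small] := word_of_small_minors mulA mulxx.
exists [:: term_graph mul m]; split.
  move=> rho; rewrite inE => /eqP-> _ [[] ->].
  exact: (@word_preserves_term_graph _ _ _ mulA _ [:: ord0; ord_max]).
move=> f; split.
  case=> t ft rho; rewrite inE => /eqP->.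
  have [w w0 wt] := word_of_term mulA t.
  by apply: (word_preserves_term_graph mulA w0) => x; rewrite wt ft.
move=> /(_ (term_graph mul m)); rewrite inE eqxx => /(_ isT) pres.
apply/CloP => //.
have [|g|w wf] := small _ (ord0 : 'I_(arity f)) (fun c => f [tuple c i | i < arity f]).
- by move=> c d cd; congr (f _); apply: eq_from_tnth => i; rewrite !tnth_mktuple.
- have := pres [tuple [tuple (enum_val c : {ffun 'I_m -> S}) (g i) | i < arity f]
                  | c < #|{: {ffun 'I_m -> S}}|].
  case/(_ _)/(term_graphP mulA) => [j|w _ wf].
    apply/(term_graphP mulA); exists [:: g j] => // c.
    by rewrite ev1 !tnth_mktuple.
  exists w => c; have := wf (enum_rank [ffun i => c i]).
  rewrite !tnth_mktuple enum_rankK => wE.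
  rewrite -(@eq_ev _ _ _ [ffun i => c i]) => [|i]; last by rewrite ffunE.
  rewrite wE; congr (Some (f _)); apply: eq_from_tnth => i.
  by rewrite !tnth_mktuple ffunE.
exists w => x; rewrite wf; congr (Some (f _)).
by apply: eq_from_tnth => i; rewrite !tnth_mktuple.
Qed.
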